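(* For each $n>1$, there exists an NBW $\mathcal{B}_n$ with $n$ states over a seven-letter alphabet such that $L(n)\leq C_{\mathrm{NBW}}(\mathcal{B}_n)$.
   Context: An NBW is $(\Sigma,S,I,\Delta,F)$ with finite $\Sigma$, finite $S$, $I,F\subseteq S$, $\Delta\subseteq S\times\Sigma\times S$; $\alpha\in\Sigma^\omega$ is accepted if there is a run $\rho(0)\rho(1)\cdots$ with $\rho(0)\in I$, $\langle\rho(i),\alpha(i),\rho(i+1)\rangle\in\Delta$ for all $i$, visiting $F$ infinitely often. $C_{\mathrm{NBW}}(\mathcal{A})$ is the minimum number of states of an NBW over the same alphabet accepting $\Sigma^\omega\setminus\mathcal{L}(\mathcal{A})$. For $n>1$ let $S'_n$ be a set of $n-1$ elements; for $1\le m<n$, a $Q(m)$-ranking is a function $h:S'_n\to\{0,1,\dots,2m-1\}$ such that every odd number $1,3,\dots,2m-1$ is a value of $h$; $L(n,m)$ is the number of $Q(m)$-rankings and $L(n)=\max_{1\le m<n}L(n,m)$. *)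

(* Defs.v *)
From mathcomp Require Import all_boot.
From mathcomp Require Import boolp.

Set Implicit Arguments.
Unset Strict Implicit.
Unset Printing Implicit Defensive.

Record nbw (Sigma : finType) := NBW {
  state : finType;
  init : {set state};
  trans : {set state * Sigma * state};
  final : {set state}
}.

Definition is_run (Sigma : finType) (A : nbw Sigma)
    (alpha : nat -> Sigma) (rho : nat -> state A) : Prop :=
  rho 0 \in init A /\
  forall i, (rho i, alpha i, rho i.+1) \in trans A.

Definition accepts (Sigma : finType) (A : nbw Sigma)
    (alpha : nat -> Sigma) : Prop :=
  exists2 rho : nat -> state A,
    is_run alpha rho & forall N, exists2 i, N <= i & rho i \in final A.

Definition complements (Sigma : finType) (B A : nbw Sigma) : Prop :=
  forall alpha, accepts B alpha <-> ~ accepts A alpha.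

Definition has_complement_of_size (Sigma : finType) (A : nbw Sigma) : pred nat :=
  fun k => `[< exists2 B : nbw Sigma, #|state B| = k & complements B A >].

(* By Buechi's complementation theorem the minimum always exists, so the
   default value 0 is never used; it cannot make a positive lower bound hold
   vacuously either. *)
Definition C_NBW (Sigma : finType) (A : nbw Sigma) : nat :=
  if pselect (exists k, has_complement_of_size A k) is left ex
  then ex_minn ex else 0.

(* The codomain 'I_(2 * m) is {0, ..., 2m-1}. *)
Definition Q_ranking (T : finType) (m : nat) (h : {ffun T -> 'I_(2 * m)}) : bool :=
  [forall k : 'I_(2 * m), odd k ==> [exists s, h s == k]].

Definition num_Q_rankings (n m : nat) : nat :=
  #|[set h : {ffun 'I_n.-1 -> 'I_(2 * m)} | Q_ranking h]|.

Definition L (n : nat) : nat := \max_(1 <= m < n) num_Q_rankings n m.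

(* Main.v *)
(* For rankings f and g there is a word reading which a run can get from s to t
   through the final state iff f s > g t, and otherwise only if f s >= g t,
   with equality at odd values always possible.  A word that chains
   such factors through all Q(m)-rankings infinitely often is rejected, since
   ranks decrease along every run.  If a complement of the automaton used one
   state at two rankings f <> g, say with f x < g x, then pumping a factor
   leading from g to f would give a word it accepts; but that factor carries a
   loop on x through the final state.  Hence distinct rankings need distinct
   states.  Because C_NBW is 0 without a complement, Buechi's complementation
   theorem is needed as well. *)

Require Import Defs.
From mathcomp Require Import all_boot all_fingroup all_algebra.
From mathcomp Require Import boolp zify.

Set Implicit Arguments.
Unset Strict Implicit.
Unset Printing Implicit Defensive.

(** * Infinite pigeonhole, and infinite words cut into blocks *)

Lemma pigeonhole_infinite (T : finType) (Q : nat -> Prop) (f : nat -> T) :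
  (forall N, exists2 k, N <= k & Q k) ->
  exists t, forall N, exists2 k, N <= k & Q k /\ f k = t.
Proof.
move=> Qinf; apply: contrapT => /forallNP noT.
have /choice[B BP] : forall t, exists N, forall k, N <= k -> Q k -> f k <> t.
  move=> t; have /existsNP[N NP] := noT t.
  exists N => k Nk Qk fk; apply: NP; by exists k.
have [k /bigmax_leqP/= Bk Qk] := Qinf (\max_t B t).
exact: (BP (f k) k (Bk _ isT) Qk).
Qed.

Section Blocks.

Variable P : nat -> nat.
Hypotheses (P0 : P 0 = 0) (P_lt : forall k, P k < P k.+1).

Fixpoint block (i : nat) : nat :=
  if i is i'.+1 then
    if i == P (block i').+1 then (block i').+1 else block i'
  else 0.

Lemma blockP i : P (block i) <= i < P (block i).+1.
Proof.
elim: i => [|i /andP[le_i lt_i]] /=; first by have := P_lt 0; rewrite P0 => ->.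
case: eqP => [->|/eqP ne]; first by rewrite leqnn P_lt.
by rewrite leqW //= ltn_neqAle ne.
Qed.

Lemma bounds_homo : {homo P : i j / i <= j}.
Proof. by apply: homo_leq leqnn leq_trans _ => k; apply: ltnW. Qed.

Lemma bounds_ge k : k <= P k.
Proof. by elim: k => // k /leq_ltn_trans-> //. Qed.

Lemma block_eq k i : P k <= i < P k.+1 -> block i = k.
Proof.
move=> /andP[Pk iP]; have /andP[Pb iPb] := blockP i.
by case: (ltngtP (block i) k) => // /bounds_homo; lia.
Qed.

End Blocks.

Section Factor.

Variable Sigma : Type.

Definition factor (alpha : nat -> Sigma) (i j : nat) : seq Sigma :=
  [seq alpha k | k <- iota i (j - i)].

Lemma factor_nil alpha i : factor alpha i i = [::].
Proof. by rewrite /factor subnn. Qed.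

Lemma factor_cat alpha i j k :
  i <= j -> j <= k -> factor alpha i k = factor alpha i j ++ factor alpha j k.
Proof.
move=> ij jk; have kiE : k - i = (j - i) + (k - j) by lia.
by rewrite /factor kiE iotaD map_cat subnKC.
Qed.

Lemma factor_cons alpha i j :
  i < j -> factor alpha i j = alpha i :: factor alpha i.+1 j.
Proof. by move=> ij; rewrite /factor -(subnSK ij). Qed.

Lemma factor_rcons alpha i j :
  i <= j -> factor alpha i j.+1 = rcons (factor alpha i j) (alpha j).
Proof.
by move=> ij; rewrite (factor_cat _ ij (leqnSn j)) (factor_cons _ (ltnSn j))
  factor_nil cats1.
Qed.

(** No word is empty, so the first [i.+1] words have total length above [i] and already determine
    letter [i]; [a0] only serves as the default of [nth]. *)
Lemma concat_blocks (w : nat -> seq Sigma) :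
  (forall k, 0 < size (w k)) ->
  exists alpha P, [/\ P 0 = 0, forall k, P k < P k.+1 &
    forall k, factor alpha (P k) (P k.+1) = w k].
Proof.
move=> w_gt0.
pose pre k := flatten [seq w i | i <- iota 0 k].
have preS k : pre k.+1 = pre k ++ w k.
  by rewrite /pre -addn1 iotaD map_cat flatten_cat /= cats0.
have pre_lt k : size (pre k) < size (pre k.+1).
  by rewrite preS size_cat -{1}[size (pre k)]addn0 ltn_add2l.
have [a0 _] : exists a0 : Sigma, True.
  by have := w_gt0 0; case: (w 0) => // a0 _ _; exists a0.
have pre_ge k : k <= size (pre k).
  by elim: k => // k IH; apply: leq_ltn_trans (pre_lt k).
have preP k i d : i < size (pre k) -> nth a0 (pre (k + d)) i = nth a0 (pre k) i.
  move=> ik; elim: d => [|d IHd]; first by rewrite addn0.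
  rewrite addnS preS nth_cat.
  suff -> : i < size (pre (k + d)) by [].
  apply: leq_trans ik _; elim: d {IHd} => [|d IHd]; first by rewrite addn0.
  by rewrite addnS; apply: leq_trans IHd (ltnW (pre_lt _)).
pose alpha i := nth a0 (pre i.+1) i.
have alphaE k i : i < size (pre k) -> alpha i = nth a0 (pre k) i.
  move=> ik; rewrite /alpha; have [le|lt] := leqP k i.+1.
    by rewrite -(subnKC le) preP.
  by rewrite -(subnKC (ltnW lt)) preP.
exists alpha, (fun k => size (pre k)); split=> // k.
apply: (@eq_from_nth _ a0).
  by rewrite /factor size_map size_iota preS size_cat addKn.
rewrite /factor size_map size_iota => i ik.
rewrite (nth_map 0) ?size_iota // nth_iota // (alphaE k.+1) ?preS; last first.
  by rewrite -preS; lia.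
by rewrite nth_cat ltnNge leq_addr /= addKn.
Qed.

End Factor.

(** * Finite paths and acceptance along blocks *)

Section Reach.

Variables (Sigma : finType) (A : nbw Sigma).
Implicit Types (alpha : nat -> Sigma) (p q r : state A) (b : bool).

(* The flag tells whether the path meets a final state after its origin, so
   that flags combine disjunctively under concatenation. *)
Fixpoint reach (w : seq Sigma) p b q : bool :=
  if w is a :: w' then
    [exists r, ((p, a, r) \in trans A) &&
      [exists b', reach w' r b' q && (b == ((r \in final A) || b'))]]
  else (q == p) && ~~ b.

Lemma reach_cons a w p b q :
  reach (a :: w) p b q <->
  exists r b', [/\ (p, a, r) \in trans A, reach w r b' q &
                   b = (r \in final A) || b'].
Proof.
split=> [/existsP[r /andP[pr /existsP[b' /andP[rq /eqP bE]]]]|].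
  by exists r, b'.
case=> r [b' [pr rq bE]]; apply/existsP; exists r; apply/andP; split=> //.
by apply/existsP; exists b'; apply/andP; rewrite bE eqxx.
Qed.

Lemma reach_cat u v p b q :
  reach (u ++ v) p b q <->
  exists r b1 b2, [/\ reach u p b1 r, reach v r b2 q & b = b1 || b2].
Proof.
elim: u p b => [|a u IH] p b.
  split=> [pq|[r [b1 [b2 [/= /andP[/eqP-> /negbTE-> rq ->]]]]]] //.
  by exists p, false, b; rewrite /= eqxx.
rewrite cat_cons reach_cons; split.
  case=> r [b' [pr /IH[r' [b1 [b2 [rr' r'q ->]]]] ->]].
  exists r', ((r \in final A) || b1), b2; split=> //; last by rewrite orbA.
  by apply/reach_cons; exists r, b1.
case=> r [b1 [b2 [/reach_cons[r' [b' [pr' r'r ->]]] rq ->]]].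
exists r', (b' || b2); split=> //; last by rewrite orbA.
by apply/IH; exists r, b', b2.
Qed.

Lemma run_reach alpha (rho : nat -> state A) i j :
  (forall k, (rho k, alpha k, rho k.+1) \in trans A) -> i <= j ->
  reach (factor alpha i j) (rho i)
    (has (fun k => rho k.+1 \in final A) (iota i (j - i))) (rho j).
Proof.
move=> tr /subnKC <-; rewrite addKn; move: (j - i) => d.
elim: d i => [|d IH] i.
  by rewrite addn0 factor_nil /= eqxx.
rewrite factor_cons ?addnS ?ltnS ?leq_addr //; apply/reach_cons.
by rewrite -addSn; exists (rho i.+1); eexists; split; [exact: tr|exact: IH|].
Qed.

Lemma reach_run alpha i j p b q :
  i <= j -> reach (factor alpha i j) p b q ->
  exists sigma : nat -> state A, [/\ sigma i = p, sigma j = q,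
    forall k, i <= k < j -> (sigma k, alpha k, sigma k.+1) \in trans A &
    b -> exists2 k, i < k <= j & sigma k \in final A].
Proof.
move=> /subnKC <-; move: (j - i) => d; elim: d i p b => [|d IH] i p b.
  rewrite addn0 factor_nil /= => /andP[/eqP-> /negbTE->].
  by exists (fun=> p); split=> // k; lia.
rewrite factor_cons ?addnS ?ltnS ?leq_addr // => /reach_cons[r [b' [pr rq ->]]].
rewrite -addSn in rq *; have [sg [sgi sgj tr fin]] := IH _ _ _ rq.
exists (fun k => if k == i then p else sg k); split.
- by rewrite eqxx.
- by rewrite ifN //; lia.
- move=> k /andP[]; rewrite leq_eqVlt => /predU1P[<- _|ik kj].
    by rewrite eqxx ifN ?sgi //; lia.
  by rewrite !ifN; [apply: tr; lia|lia|lia].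
case/orP => [rF|/fin[k ik kF]].
  by exists i.+1; rewrite ?ifN ?sgi //; lia.
by exists k; rewrite ?ifN //; lia.
Qed.

(** Flags ignore the origin of a path, so each position after 0 is counted in exactly one block.
    Conversely, paths chosen block by block agree at the boundaries and glue to a run. *)
Lemma accepts_blocks alpha P : P 0 = 0 -> (forall k, P k < P k.+1) ->
  accepts A alpha <->
  exists (q : nat -> state A) (b : nat -> bool), [/\ q 0 \in init A,
    forall k, reach (factor alpha (P k) (P k.+1)) (q k) (b k) (q k.+1) &
    forall N, exists2 k, N <= k & b k].
Proof.
move=> P0 P_lt; split=> [[rho [rho0 tr] inf]|[q [b [q0 qP inf]]]].
  exists (rho \o P), (fun k => has (fun i => rho i.+1 \in final A)
    (iota (P k) (P k.+1 - P k))); split=> [|k|N] /=.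
  - by rewrite P0.
  - by apply: run_reach (ltnW _).
  (* The successor in the bound excludes position 0: the final position is [i.+1] with [P N <= i],
     and [i] lies in a block of index at least [N]. *)
  have [[//|i] lei iF] := inf (P N).+1.
  have /andP[Pi iP] := blockP P0 P_lt i.
  exists (block P i).
    rewrite leqNgt; apply/negP => /(bounds_homo P_lt); lia.
  by apply/hasP; exists i => //; rewrite mem_iota; lia.
have /choice[sg sgP] := fun k => reach_run (ltnW (P_lt k)) (qP k).
have sgE k : sg k (P k.+1) = sg k.+1 (P k.+1).
  by have [_ -> _ _] := sgP k; have [-> _ _ _] := sgP k.+1.
pose rho i := sg (block P i) i.
have rhoE k i : P k <= i <= P k.+1 -> rho i = sg k i.
  move=> /andP[ki]; rewrite leq_eqVlt => /predU1P[iE|ik].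
    by rewrite /rho (@block_eq P P0 P_lt k.+1) iE ?leqnn ?P_lt // sgE.
  by rewrite /rho (@block_eq P P0 P_lt k) ?ki.
exists rho.
  split=> [|i].
    rewrite (@rhoE 0) ?P0 //; have [+ _ _ _] := sgP 0.
    by rewrite P0 => ->.
  have /andP[Pi iP] := blockP P0 P_lt i; have [_ _ tr _] := sgP (block P i).
  by rewrite !(@rhoE (block P i)) ?tr //; lia.
move=> N; have [k Nk bk] := inf N.
have [_ _ _ /(_ bk)[i /andP[ki ik] iF]] := sgP k.
exists i; last by rewrite (@rhoE k) // ik ltnW.
have := bounds_ge P_lt k; lia.
Qed.

End Reach.

(** * Büchi's complementation theorem *)

Section Complementation.

Variables (Sigma : finType) (A : nbw Sigma).
Implicit Types (alpha : nat -> Sigma) (u v w : seq Sigma).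

(** Profiles are the classes of Büchi's congruence: there are finitely many, [profile_mul]
    multiplies them, and factors of equal profile are interchangeable for acceptance. *)
Definition profile := {set state A * bool * state A}.

Definition profile_of w : profile :=
  [set x | reach w x.1.1 x.1.2 x.2].

Definition profile_mul (s t : profile) : profile :=
  [set x : state A * bool * state A | [exists r : state A, exists b1 : bool,
    exists b2 : bool, [&& (x.1.1, b1, r) \in s, (r, b2, x.2) \in t &
                          x.1.2 == b1 || b2]]].

Lemma profile_of_cat u v :
  profile_of (u ++ v) = profile_mul (profile_of u) (profile_of v).
Proof.
apply/setP => -[[p b] q]; rewrite !inE /=; apply/idP/idP.
  case/reach_cat => r [b1 [b2 [pr rq ->]]].
  apply/existsP; exists r; apply/existsP; exists b1; apply/existsP; exists b2.
  by rewrite !inE pr rq eqxx.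
case/existsP => r /existsP[b1 /existsP[b2]]; rewrite !inE /=.
by case/and3P => pr rq /eqP->; apply/reach_cat; exists r, b1, b2.
Qed.

Lemma profile_factor_cat alpha i j k : i <= j -> j <= k ->
  profile_of (factor alpha i k) =
  profile_mul (profile_of (factor alpha i j)) (profile_of (factor alpha j k)).
Proof. by move=> ij jk; rewrite (factor_cat _ ij jk) profile_of_cat. Qed.

(* Positions i and j merge when the factors starting there eventually have the
   same profile.  Merging has at most #|profile| classes, so some position i0
   merges with infinitely many others; this replaces Ramsey's theorem. *)
Definition merge alpha i j :=
  exists m, forall m', m <= m' ->
    profile_of (factor alpha i m') = profile_of (factor alpha j m').

Lemma merge_of_eq alpha i j m : i <= m -> j <= m ->
  profile_of (factor alpha i m) = profile_of (factor alpha j m) ->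
    merge alpha i j.
Proof.
move=> im jm eq_m; exists m => m' mm'.
by rewrite (profile_factor_cat _ im mm') (profile_factor_cat _ jm mm') eq_m.
Qed.

Lemma merge_infinite alpha :
  exists i0, forall N, exists2 j, N <= j & merge alpha i0 j.
Proof.
apply: contrapT => /forallNP no.
have /choice[B BP] : forall i, exists N, forall j, N <= j -> ~ merge alpha i j.
  move=> i; have /existsNP[N NP] := no i.
  by exists N => j Nj ij; apply: NP; exists j.
(* Each new position lies beyond the merge bounds of all earlier ones, which yields one more
   pairwise unmerged position than there are profiles. *)
have [s s_size s_pw] : exists2 s, size s = #|{: profile}|.+1 &
    pairwise (fun j i => ~~ `[< merge alpha i j >]) s.
  elim: #|{: profile}|.+1 => [|d [s <- s_pw]]; first by exists [::].
  exists ((\max_(i <- s) B i) :: s) => //=.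
  rewrite s_pw andbT; apply/allP => i si.
  by apply/asboolPn; apply: BP; rewrite (big_rem i) //= leq_maxl.
pose m := \max_(i <- s) i.
have s_m i : i \in s -> i <= m.
  by move=> si; rewrite /m (big_rem i) //= leq_maxl.
(* Two unmerged positions still have different profiles when compared at the common later position
   [m]. *)
have : uniq [seq profile_of (factor alpha i m) | i <- s].
  rewrite uniq_pairwise pairwise_map; move: s_pw.
  apply: (@sub_in_pairwise _ (mem s)); last exact/allP.
  move=> j i sj si /= /asboolPn nij; apply/eqP => /esym eq_m; apply: nij.
  by apply: merge_of_eq eq_m; apply: s_m.
move=> /card_uniqP.
have := max_card [in [seq profile_of (factor alpha i m) | i <- s]].
by rewrite size_map s_size => + E; rewrite E ltnn.
Qed.

(** Infinitely many positions [j] merge with [i0] and have the same profile [e] seen from [i0]. If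
    the next such [j'] is chosen after [i0] and [j] have merged, the factor from [j] to [j'] has the
    profile of the one from [i0] to [j'], which is [e]. *)
Lemma profile_factorization alpha :
  exists P s e, [/\ P 0 = 0, forall k, P k < P k.+1,
    profile_of (factor alpha (P 0) (P 1)) = s &
    forall k, profile_of (factor alpha (P k.+1) (P k.+2)) = e].
Proof.
have [i0 i0P] := merge_infinite alpha.
have [e eP] :=
  pigeonhole_infinite (fun j => profile_of (factor alpha i0 j)) i0P.
have /choice[next nextP] : forall j, exists j',
    i0 <= j -> merge alpha i0 j -> profile_of (factor alpha i0 j) = e ->
    [/\ j < j', merge alpha i0 j', profile_of (factor alpha i0 j') = e &
        profile_of (factor alpha j j') = e].
  move=> j; have [[i0j [[m mP] ej]]|no] := pselect (i0 <= j /\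
    merge alpha i0 j /\ profile_of (factor alpha i0 j) = e);
    last by exists 0 => *; case: no.
  have [j' jj' [mj' ej']] := eP (maxn m j.+1).
  rewrite geq_max in jj'; case/andP: jj' => mj'' jj'.
  by exists j' => _ _ _; split=> //; rewrite -mP.
have [j1 j1P [mj1 ej1]] := eP i0.+1.
pose P k := if k is k'.+1 then iter k' next j1 else 0.
have PP k : [/\ i0 < P k.+1, merge alpha i0 (P k.+1) &
                profile_of (factor alpha i0 (P k.+1)) = e].
  elim: k => [|k [ik mk ek]] //=.
  by have [lt_k ? ? _] := nextP _ (ltnW ik) mk ek; split=> //;
    exact: ltn_trans ik lt_k.
exists P, (profile_of (factor alpha 0 j1)), e; split=> //.
  move=> [|k]; first exact: leq_ltn_trans j1P.
  by have [ik mk ek] := PP k; have [] := nextP _ (ltnW ik) mk ek.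
by move=> k; have [ik mk ek] := PP k; have [] := nextP _ (ltnW ik) mk ek.
Qed.

(** Acceptance of a word with factor profiles s, e, e, ... depends on the pair alone, so a
    complement automaton can guess the pair and test it in its initial state. *)
Definition rejecting (s e : profile) : Prop :=
  ~ exists (q : nat -> state A) (b : nat -> bool), [/\ q 0 \in init A,
      (q 0, b 0, q 1) \in s,
      forall k, (q k.+1, b k.+1, q k.+2) \in e &
      forall N, exists2 k, N <= k & b k].

Lemma rejecting_accepts alpha P s e :
  P 0 = 0 -> (forall k, P k < P k.+1) ->
  profile_of (factor alpha (P 0) (P 1)) = s ->
  (forall k, profile_of (factor alpha (P k.+1) (P k.+2)) = e) ->
  rejecting s e <-> ~ accepts A alpha.
Proof.
move=> P0 P_lt sE eE; rewrite (accepts_blocks A alpha P0 P_lt).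
split; apply: contra_not => -[q [b]].
  case=> q0 qS inf; exists q, b; split=> // [|k].
    by rewrite -sE inE; apply: qS.
  by rewrite -(eE k) inE; apply: qS.
case=> q0 q01 qS inf; exists q, b; split=> // -[|k].
  by move: q01; rewrite -sE inE.
by have := qS k; rewrite -(eE k) inE.
Qed.

(* A state ((s, e), (loop, cut), t) guesses that the input factors as
   u v1 v2 ... with u of profile s and all vi of profile e; t is the profile of
   the part of the current factor read so far, loop is false while reading u,
   and cut is set when a new factor vi has just begun. *)
Definition compl_state : finType :=
  (profile * profile * (bool * bool) * profile)%type.

Definition compl_step (x : compl_state) (a : Sigma) (y : compl_state) : bool :=
  let: (s, e, (loop, _), t) := x in
  let: (s', e', (loop', cut'), t') := y in
  let t1 := profile_mul t (profile_of [:: a]) in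
  [&& s' == s, e' == e &
    if cut' then [&& loop', t' == profile_of [::] & t1 == if loop then e else s]
    else (loop' == loop) && (t' == t1)].

Definition compl_nbw : nbw Sigma := {|
  state := compl_state;
  init := [set x : compl_state | `[< rejecting x.1.1.1 x.1.1.2 >] &&
             (x == (x.1.1, (false, false), profile_of [::]))];
  trans := [set x : compl_state * Sigma * compl_state |
             compl_step x.1.1 x.1.2 x.2];
  final := [set x : compl_state | x.1.2.2]
|}.

Lemma compl_nbw_complete alpha : ~ accepts A alpha -> accepts compl_nbw alpha.
Proof.
have [P [s [e [P0 P_lt sE eE]]]] := profile_factorization alpha.
move/(rejecting_accepts P0 P_lt sE eE) => rej.
(* The run follows the factorization of [alpha]. The cut flag is off at position 0, where no factor
   has been completed yet. *)
pose rho i : compl_state := let k := block P i in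
  (s, e, (0 < k, (0 < k) && (i == P k)), profile_of (factor alpha (P k) i)).
exists (rho : nat -> state compl_nbw); last first.
  move=> N; exists (P N.+1).
    exact: leq_trans (leqnSn N) (bounds_ge P_lt _).
  rewrite inE /rho /= (@block_eq P P0 P_lt N.+1) ?leqnn ?P_lt //.
  by rewrite eqxx.
split=> [|i]; rewrite inE /=.
  by rewrite /rho /= P0 factor_nil eqxx andbT; apply/asboolP.
have /andP[Pi iP] := blockP P0 P_lt i.
rewrite /rho !eqxx /=; case: eqP => [iE|/eqP iN] /=.
  rewrite iE eqxx /= factor_nil eqxx /= -profile_of_cat cats1 -factor_rcons //.
  by rewrite iE; case: (block P i) => [|k]; rewrite ?sE ?eE.
have -> : (i.+1 == P (block P i)) = false by lia.
by rewrite andbF -profile_of_cat cats1 -factor_rcons // !eqxx.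
Qed.

(** Final states are cuts, so an accepting run has infinitely many of them. Their positions,
    preceded by 0, factor the input with the guessed profiles. *)
Lemma compl_nbw_sound alpha : accepts compl_nbw alpha -> ~ accepts A alpha.
Proof.
case=> rho [+ tr] inf; rewrite inE => /andP[/asboolP].
case rho0: (rho 0) => [[[s e] [l c]] t] /= rej /eqP[lE cE tE]; subst l c t.
pose cut i := (rho i).1.2.2; pose loop i := (rho i).1.2.1.
have seE i : (rho i).1.1 = (s, e).
  elim: i => [|i]; first by rewrite rho0.
  have := tr i; rewrite inE /=.
  case: (rho i) => [[[s1 e1] [l1 c1]] t1].
  case: (rho i.+1) => [[[s2 e2] [l2 c2]] t2] /=.
  by case/and3P => /eqP-> /eqP->.
have stepP i : let t1 := profile_mul (rho i).2 (profile_of [:: alpha i]) in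
  if cut i.+1 then [&& loop i.+1, (rho i.+1).2 == profile_of [::] &
                       t1 == if loop i then e else s]
  else (loop i.+1 == loop i) && ((rho i.+1).2 == t1).
  have := tr i; rewrite inE /= /cut /loop; move: (seE i).
  case: (rho i) => [[[s1 e1] [l1 c1]] t1].
  case: (rho i.+1) => [[[s2 e2] [l2 c2]] t2] /= [-> ->].
  by case/and3P.
have cut_ex i : exists j, (i < j) && cut j.
  by have [j ij] := inf i.+1; rewrite inE => cj; exists j; rewrite ij.
pose nxt i := ex_minn (cut_ex i).
have nxtP i : (rho i).2 = profile_of [::] ->
  [/\ i < nxt i, loop (nxt i), (rho (nxt i)).2 = profile_of [::] &
      profile_of (factor alpha i (nxt i)) = if loop i then e else s].
  rewrite /nxt => ti; case: ex_minnP => j /andP[ij cj] jmin.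
  (* Up to the next cut, the last component accumulates the profile of the factor that starts at
     [i]. *)
  have between d : i + d < j ->
    loop (i + d) = loop i /\ (rho (i + d)).2 = profile_of (factor alpha i (i +
      d)).
    elim: d => [|d IH]; rewrite ?addn0 ?factor_nil // addnS => dj.
    have [lE tE] := IH (ltnW dj).
    have := stepP (i + d) => /=; case: ifP => [c|_ /andP[/eqP-> /eqP->]].
      by have := jmin _ (introT andP (conj _ c)); lia.
    by rewrite tE -profile_of_cat cats1 -factor_rcons ?leq_addr.
  have [d jE] : exists d, j = (i + d).+1 by exists (j - i.+1); lia.
  subst j; have [|lE tE] := between d; first exact: ltnSn.
  have /= := stepP (i + d); rewrite cj => /and3P[-> /eqP-> /eqP].
  by rewrite lE tE -profile_of_cat cats1 -factor_rcons ?leq_addr.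
pose P k := iter k nxt 0.
have PP k : (rho (P k)).2 = profile_of [::].
  by elim: k => [|k /nxtP[]] //; rewrite rho0.
apply: (iffLR (@rejecting_accepts alpha P s e _ _ _ _)) => // [k||k].
- by have [] := nxtP _ (PP k).
- by have [_ _ _] := nxtP _ (PP 0); rewrite /= /loop rho0.
- by have [_ _ _] := nxtP _ (PP k.+1); have [_ -> _ _] := nxtP _ (PP k).
Qed.

Lemma complement_exists : exists k, has_complement_of_size A k.
Proof.
exists #|compl_state|; apply/asboolP; exists compl_nbw => // alpha.
by split=> [/compl_nbw_sound|/compl_nbw_complete].
Qed.

End Complementation.

(** * Fooling words of the form u v v v ..., and the bound they give *)

Definition pumpable (Sigma : finType) (A : nbw Sigma) (I : Type)
    (alpha : nat -> Sigma) (P : nat -> nat) (R : nat -> I) (f g : I) : Prop :=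
  forall k l beta Q, 0 < k < l -> R k = g -> R l = f ->
    Q 0 = 0 -> (forall j, Q j < Q j.+1) ->
    factor beta (Q 0) (Q 1) = factor alpha 0 (P k) ->
    (forall j, factor beta (Q j.+1) (Q j.+2) = factor alpha (P k) (P l)) ->
    accepts A beta.

(* If a complement reaches the same state q at positions labelled g and later
   f, with a final state in between, then it accepts the word obtained by
   pumping the factor between them. *)
Lemma fooling_bound (Sigma : finType) (A : nbw Sigma) (I : finType)
    (alpha : nat -> Sigma) (P : nat -> nat) (R : nat -> I) :
  P 0 = 0 -> (forall k, P k < P k.+1) ->
  (forall i N, exists2 k, N <= k & R k = i) ->
  ~ accepts A alpha ->
  (forall f g, f != g ->
    pumpable A alpha P R f g \/ pumpable A alpha P R g f) ->
  #|I| <= C_NBW A.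
Proof.
move=> P0 P_lt R_inf alphaN pump; rewrite /C_NBW.
case: pselect => [ex|[]]; last exact: complement_exists.
case: ex_minnP => _ /asboolP[B <- compl] _.
have [rho [rho0 tr] fin] := iffRL (compl alpha) alphaN.
(* [q i] is a state that the accepting run visits at infinitely many boundaries labelled [i]. *)
have /choice[q qP] i := pigeonhole_infinite (fun k => rho (P k)) (R_inf i).
suff q_inj : injective q by apply: leq_card q_inj.
have no_pump f g : q f = q g -> ~ pumpable A alpha P R f g.
  move=> qfg pfg; have [k k_gt0 [Rk rk]] := qP g 1.
  (* The boundary [l] is taken beyond a final position [t > P k], so the pumped factor from [P k] to
     [P l] contains a final visit. *)
  have [t kt tF] := fin (P k).+1; have [l tl [Rl rl]] := qP f t.
  have Pl := bounds_ge P_lt l; have Pk := bounds_ge P_lt k.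
  have kl : k < l.
    by rewrite ltnNge; apply/negP => /(bounds_homo P_lt); lia.
  have Pkl : P k < P l by lia.
  pose w j := if j is 0 then factor alpha 0 (P k) else factor alpha (P k) (P l).
  have [|beta [Q [Q0 Q_lt QE]]] := concat_blocks (w := w).
    by case=> [|j]; rewrite size_map size_iota; lia.
  have betaA : accepts A beta.
    by apply: pfg Rk Rl Q0 Q_lt (QE 0) _ => [|j]; [rewrite k_gt0|exact: QE].
  (* Acceptance by the complement contradicts [betaA]. The accepting path repeats the loop on
     [q g = q f]. *)
  suff /compl : accepts B beta by [].
  apply/(accepts_blocks B beta Q0 Q_lt).
  pose vis i j := has (fun k => rho k.+1 \in final B) (iota i (j - i)).
  exists (fun j => if j is 0 then rho 0 else q g).
  exists (fun j => if j is 0 then vis 0 (P k) else vis (P k) (P l)).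
  split=> // [j|N].
    rewrite QE; case: j => [|j]; first by rewrite -rk; apply: run_reach.
    by rewrite -{1}rk -qfg -rl; apply: run_reach => //; apply: ltnW.
  exists N.+1 => //; apply/hasP; exists t.-1; last by rewrite prednK //; lia.
  by rewrite mem_iota; lia.
move=> f g qfg; apply: contrapT => /eqP/pump.
by case=> [/(no_pump _ _ qfg)|/(no_pump _ _ (esym qfg))].
Qed.

Lemma decreasing_absurd (v : nat -> nat) (b : nat -> bool) :
  (forall k, v k.+1 <= v k) -> (forall k, b k -> v k.+1 < v k) ->
  ~ (forall N, exists2 k, N <= k & b k).
Proof.
move=> v_le v_lt inf.
have v_homo : {homo v : i j / i <= j >-> j <= i}.
  by apply: homo_leq => // x y z yx zy; apply: leq_trans zy yx.
suff /(_ (v 0).+1)[k] : forall M, exists k, v k + M <= v 0 by lia.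
elim=> [|M [k kM]]; first by exists 0; rewrite addn0.
have [j kj /v_lt] := inf k; exists j.+1; have := v_homo _ _ kj; lia.
Qed.

(** * The seven-letter automaton and the relations its words induce *)

Section SevenLetters.

Variables (X : finType) (x0 x1 : X) (c : {perm X}).
Hypothesis gen : <<[set tperm x0 x1; c]>>%g = [set: {perm X}].
Hypothesis x01 : x0 = x1 -> forall x y : X, x = y.

(* [None] is the unique final state; [Some x] ranges over S'_n. *)
Definition letter_step (a : nat) (p q : option X) : bool :=
  match a with
  | 0 => q == omap (tperm x0 x1) p
  | 1 => q == omap c p
  | 2 => (q == p) || (p == Some x0) && (q == None)
  | 3 => (q == p) || (p == None) && (q == Some x0)
  | 4 => (q == p) && (p != None)
  | 5 => (q == p) && (p != Some x0)
  | _ => (q == p) || (p == Some x0) && (q == Some x1)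
  end.

Definition seven_nbw : nbw 'I_7 := {|
  state := option X;
  init := [set p : option X | p != None];
  trans := [set x : option X * 'I_7 * option X |
             letter_step x.1.2 x.1.1 x.2];
  final := [set None]
|}.

Implicit Types (p q r : option X) (b : bool) (w : seq 'I_7) (s t : X).

Local Notation reach := (@reach 'I_7 seven_nbw).

(** The coercions [p -> q] say that both ends are nonfinal: between such ends no path visits [None].
    The flag of other paths is left open. *)
Definition implements w (E : rel (option X)) :=
  (forall p b q, reach w p b q -> E p q /\ (p -> q -> b = false)) /\
  (forall p q, E p q -> exists b, reach w p b q).

Lemma implements_letter (a : 'I_7) : implements [:: a] (letter_step a).
Proof.
split=> [p b q /reach_cons[r [b' [+ /andP[/eqP-> /negbTE-> ->]]]]|p q pq].
  by rewrite !inE /= orbF => pr; split=> // _; case: r {pr}.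
by exists (q == None); apply/reach_cons; exists q, false;
  rewrite !inE /= eqxx orbF.
Qed.

Lemma implements_ex E E' : E =2 E' ->
  (exists w, implements w E) -> exists w, implements w E'.
Proof.
move=> EE' [w [wE Ew]]; exists w; split=> [p b q|p q]; rewrite -EE';
  first exact: wE.
exact: Ew.
Qed.

(** In a finite group every element is a product of generators without inverses, hence spelled by
    letters 0 and 1. *)
Lemma perm_word (pi : {perm X}) :
  exists w, implements w (fun p q => q == omap pi p).
Proof.
have /gen_prodgP[n [d dA ->]] : pi \in <<[set tperm x0 x1; c]>>%g.
  by rewrite gen inE.
apply: (big_ind (fun pi : {perm X} => exists w, implements w
  (fun p q => q == omap pi p))) => [|pi1 pi2 [w1 [w1E Ew1]] [w2 [w2E Ew2]]|i _].
- exists [::]; split=> [p b q /andP[/eqP-> /negbTE->]|p q /eqP->].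
    by split=> //; case: p => //= x; rewrite perm1.
  by exists false; rewrite /= andbT; case: p => //= x; rewrite perm1.
- exists (w1 ++ w2); split=> [p b q|].
    move=> /reach_cat[r [b1 [b2 [/w1E + /w2E + ->]]]].
    move=> [/eqP-> b1F] [/eqP-> b2F]; split;
      last by case: p b1F b2F => //= x -> // ->.
    by case: p {b1F b2F} => //= x; rewrite permM.
  move=> p q /eqP->; have [b1 pr] := Ew1 p _ (eqxx _).
  have [b2 rq] := Ew2 _ _ (eqxx (omap pi2 (omap pi1 p))).
  exists (b1 || b2); apply/reach_cat; exists (omap pi1 p), b1, b2; split=> //.
  by case: p rq {pr} => //= x; rewrite permM.
- have := dA i; rewrite !inE => /orP[]/eqP->.
    by exists [:: inord 0]; have := implements_letter (inord 0); rewrite inordK.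
  by exists [:: inord 1]; have := implements_letter (inord 1); rewrite inordK.
Qed.

(** Conjugation carries the letters acting at [x0] and [x1] to arbitrary points; this is how a fixed
    alphabet serves every n. *)
Lemma conj_word (pi : {perm X}) w E : implements w E ->
  exists w', implements w' (fun p q => E (omap pi p) (omap pi q)).
Proof.
move=> [wE Ew]; have [w1 [w1E Ew1]] := perm_word pi.
have [w2 [w2E Ew2]] := perm_word pi^-1.
have piK : cancel (omap pi^-1%g) (omap pi) by case=> //= x; rewrite permKV.
have piVK : cancel (omap pi) (omap pi^-1%g) by case=> //= x; rewrite permK.
exists (w1 ++ w ++ w2); split=> [p b q /reach_cat[r [b1 [b2 [/w1E[/eqP->
  b1F]]]]]|].
  move=> /reach_cat[r' [b3 [b4 [/wE[pr b3F] /w2E[/eqP-> b4F] ->]]] ->].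
  split; first by rewrite piK.
  by case: p r' b1F b3F b4F {pr} => [x|] [y|] //= -> // -> // ->.
move=> p q /Ew[b2 rr']; have [b1 pr] := Ew1 p _ (eqxx _).
have [b3 r'q] := Ew2 _ _ (eqxx (omap pi^-1%g (omap pi q))).
rewrite piVK in r'q; exists (b1 || (b2 || b3)); apply/reach_cat.
exists (omap pi p), b1, (b2 || b3); split=> //.
by apply/reach_cat; exists (omap pi q), b2, b3.
Qed.

Lemma omap_perm_eq (pi : {perm X}) p q : (omap pi p == omap pi q) = (p == q).
Proof.
by case: p q => [x|] [y|] //=; rewrite (inj_eq Some_inj) (inj_eq perm_inj).
Qed.

Lemma omap_perm_None (pi : {perm X}) p : (omap pi p == None) = (p == None).
Proof. exact: (omap_perm_eq pi p None). Qed.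

Lemma omap_perm_Some (pi : {perm X}) p x :
  (omap pi p == Some (pi x)) = (p == Some x).
Proof. exact: (omap_perm_eq pi p (Some x)). Qed.

Lemma collect_word x :
  exists w, implements w (fun p q => (q == p) || (p == Some x) && (q == None)).
Proof.
have [pi pix] : exists pi : {perm X}, pi x = x0.
  by exists (tperm x x0); rewrite tpermL.
have := implements_letter (inord 2); rewrite inordK //.
move/(conj_word pi); apply: implements_ex => p q /=.
by rewrite -pix omap_perm_Some omap_perm_eq omap_perm_None.
Qed.

Lemma release_word x :
  exists w, implements w (fun p q => (q == p) || (p == None) && (q == Some x)).
Proof.
have [pi pix] : exists pi : {perm X}, pi x = x0.
  by exists (tperm x x0); rewrite tpermL.
have := implements_letter (inord 3); rewrite inordK //.
move/(conj_word pi); apply: implements_ex => p q /=.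
by rewrite -pix omap_perm_Some omap_perm_eq omap_perm_None.
Qed.

Lemma kill_word x :
  exists w, implements w (fun p q => (q == p) && (p != Some x)).
Proof.
have [pi pix] : exists pi : {perm X}, pi x = x0.
  by exists (tperm x x0); rewrite tpermL.
have := implements_letter (inord 5); rewrite inordK //.
move/(conj_word pi); apply: implements_ex => p q /=.
by rewrite -pix omap_perm_Some omap_perm_eq.
Qed.

Lemma copy_word x y : x != y ->
  exists w, implements w (fun p q => (q == p) || (p == Some x) && (q == Some
    y)).
Proof.
move=> xy; have x0x1 : x0 != x1 by apply: contra_neq xy => E; apply: x01.
(* The first transposition sends [x] to [x0]; the second sends the image of [y] to [x1] and fixes
   [x0], as neither of its points is [x0]. *)
pose pi := (tperm x x0 * tperm (tperm x x0 y) x1)%g.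
have pix : pi x = x0.
  rewrite permM tpermL tpermD // eq_sym //.
  by rewrite -(inj_eq (@perm_inj _ (tperm x x0))) tpermR tpermK.
have piy : pi y = x1 by rewrite permM tpermL.
have := implements_letter (inord 6); rewrite inordK //.
move/(conj_word pi); apply: implements_ex => p q /=.
by rewrite -pix -piy !omap_perm_Some omap_perm_eq.
Qed.

Lemma reach_None w s b : reach w (Some s) b None -> b.
Proof.
elim: w s b => [|a w IH] s b // /reach_cons[r [b' [_ + ->]]].
by case: r => [x /IH->|_]; rewrite ?orbT // inE.
Qed.

(** Collect [x] into [None], release [None] to [y], then let letter 4 kill whatever stays in
    [None]. *)
Lemma final_edge_word x y : exists w,
  [/\ forall s b q, reach w (Some s) b q ->
        q = Some s /\ b = false \/ [/\ s = x, q = Some y & b],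
      forall s, reach w (Some s) false (Some s) &
      reach w (Some x) true (Some y)].
Proof.
have [w1 w1P] := collect_word x; have [w1E Ew1] := w1P.
have [w2 w2P] := release_word y; have [w2E Ew2] := w2P.
have w3P := implements_letter (inord 4); rewrite inordK // in w3P.
have [w3E Ew3] := w3P.
have stay s (w : seq 'I_7) E : implements w E -> E (Some s) (Some s) ->
    reach w (Some s) false (Some s).
  by move=> [wE Ew] /Ew[b sb]; have [_ <-] := wE _ _ _ sb.
exists (w1 ++ w2 ++ [:: inord 4]); split=> [s b q|s|].
- case/reach_cat => r1 [b1 [b' [sr1 /reach_cat[r2 [b2 [b3 [r12 r2q ->]]] ->]]]].
  have [/orP[/eqP r1E|/andP[/eqP[sx] /eqP r1E]] b1F] := w1E _ _ _ sr1; subst r1.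
    have [/= /orP[/eqP r2E|//] b2F] := w2E _ _ _ r12; subst r2.
    have [/andP[/eqP qE _] b3F] := w3E _ _ _ r2q; subst q.
    by left; rewrite b1F ?b2F ?b3F.
  have [/= /orP[/eqP r2E|/eqP r2E] _] := w2E _ _ _ r12; subst r2.
    by have [/andP[]] := w3E _ _ _ r2q.
  have [/andP[/eqP qE _] _] := w3E _ _ _ r2q.
  by right; split=> //; rewrite (reach_None sr1).
- apply/reach_cat; exists (Some s), false, false; split=> //.
    by apply: (stay _ _ _ w1P); rewrite /= eqxx.
  apply/reach_cat; exists (Some s), false, false; split=> //.
    by apply: (stay _ _ _ w2P); rewrite /= eqxx.
  by apply: (stay _ _ _ w3P); rewrite /= eqxx.
- have [|b1 xz] := Ew1 (Some x) None; first by rewrite /= ?eqxx.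
  have [|b2 zy] := Ew2 None (Some y); first by rewrite /= ?eqxx.
  have [|b3 yy] := Ew3 (Some y) (Some y); first by rewrite /= ?eqxx.
  case: b1 xz (reach_None xz) => // xz _.
  apply/reach_cat; exists None, true, (b2 || b3); split=> //.
  by apply/reach_cat; exists (Some y), b2, b3.
Qed.

(** * Words leading from one ranking to another *)

Section Rankings.

Variable m : nat.
Implicit Types f g h : X -> nat.

Definition rank_cover f := (forall x, f x < 2 * m) /\
  forall k, odd k -> k < 2 * m -> exists x, f x = k.

Definition descends f g w := forall s b q, reach w (Some s) b q ->
  exists t, [/\ q = Some t, g t <= f s & b -> g t < f s].

Lemma descends_cat f g h u v :
  descends f g u -> descends g h v -> descends f h (u ++ v).
Proof.
move=> u_le v_le s b q /reach_cat[r [b1 [b2 [/u_le[t1 [-> le1 lt1]] + ->]]]].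
move=> /v_le[t [-> le2 lt2]]; exists t; split=> //.
  exact: leq_trans le2 le1.
by case/orP => [/lt1|/lt2] lt;
  [exact: leq_ltn_trans le2 lt|exact: leq_trans lt le1].
Qed.

(** Equality at an even value is allowed but not demanded: an intermediate ranking may miss that
    value, so the demand would not survive concatenation. *)
Definition realizes f g w :=
  [/\ descends f g w,
      forall s t, g t < f s -> reach w (Some s) true (Some t) &
      forall s t, f s = g t -> odd (f s) -> reach w (Some s) false (Some t)].

(** An odd rank [f s] is a value of [g], so a path can keep it first and drop later. A positive even
    rank drops first to the odd value [f s - 1] of [g], which is still at least [h t]. *)
Lemma realizes_cat f g h u v : rank_cover f -> rank_cover g ->
  realizes f g u -> realizes g h v -> realizes f h (u ++ v).
Proof.
move=> [f_lt _] [_ g_odd] [u_le u_lt u_eq] [v_le v_lt v_eq]; split.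
- exact: descends_cat u_le v_le.
- move=> s t hf; apply/reach_cat; case: (boolP (odd (f s))) => [f_odd|f_even].
    have [x gx] := g_odd _ f_odd (f_lt s); exists (Some x), false, true.
    by split; [exact: u_eq|apply: v_lt; rewrite gx|].
  have [||x gx] := g_odd (f s).-1; [lia|have := f_lt s; lia|].
  have gf : g x < f s by lia.
  have := leq_trans hf (leqSpred (f s)); rewrite ltnS -gx leq_eqVlt.
  case/predU1P => [hg|hg].
    exists (Some x), true, false; split=> //; first exact: u_lt.
    by apply: v_eq => //; rewrite gx; lia.
  by exists (Some x), true, true; split=> //; [exact: u_lt|exact: v_lt].
- move=> s t fh f_odd; have [x gx] := g_odd _ f_odd (f_lt s).
  apply/reach_cat; exists (Some x), false, false.
  by split=> //; [exact: u_eq|apply: v_eq; rewrite gx].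
Qed.

(** One word per admissible edge is concatenated. Each has unflagged self-loops everywhere, so
    earlier edges persist, and each descends, so no forbidden edge arises. *)
Lemma self_word f : exists2 w, realizes f f w &
  forall s, reach w (Some s) false (Some s).
Proof.
pose ok w := descends f f w /\ forall s, reach w (Some s) false (Some s).
pose adm (e : X * bool * X) := let: (s, b, t) := e in
  if b then f t < f s else (f s == f t) && odd (f s).
have okE s b t : adm (s, b, t) -> exists2 w, ok w & reach w (Some s) b (Some t).
  rewrite /adm; case: b => [ts|/andP[/eqP st _]].
    have [w [w_sound w_id w_st]] := final_edge_word s t; exists w => //.
    split=> // s' b q /w_sound[[-> ->]|[-> -> _]]; first by exists s'.
    by exists t; rewrite ltnW.
  have [<-|ts] := eqVneq s t.
    exists [::]; last by rewrite /= eqxx.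
    split=> [s' b q /andP[/eqP-> /negbTE->]|s' /=]; first by exists s'.
    by rewrite eqxx.
  have [w [wE Ew]] := copy_word ts.
  have w_false s1 t1 b : reach w (Some s1) b (Some t1) -> b = false.
    by move=> /wE[_ ->].
  exists w; last first.
    by have [|b stb] := Ew (Some s) (Some t);
      rewrite ?eqxx ?orbT // -(w_false _ _ _ stb).
  split=> [s' b q s'q|s']; last first.
    by have [|b stb] := Ew (Some s') (Some s');
      rewrite ?eqxx // -(w_false _ _ _ stb).
  have [/orP[/eqP qE|/andP[/eqP[s'E] /eqP qE]] _] := wE _ _ _ s'q; subst q.
    by exists s'; rewrite (w_false _ _ _ s'q).
  by exists t; rewrite (w_false _ _ _ s'q) s'E st.
have [w [w_le w_id] w_all] : exists2 w, ok w &
    forall e, e \in enum {: X * bool * X} -> adm e ->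
      reach w (Some e.1.1) e.1.2 (Some e.2).
  elim: (enum _) => [|[[s b] t] l [w [w_le w_id] w_l]].
    exists [::] => //.
    split=> [s' b q /andP[/eqP-> /negbTE->]|s' /=]; first by exists s'.
    by rewrite eqxx.
  have [u [u_le u_id] u_st] : exists2 u, ok u &
      adm (s, b, t) -> reach u (Some s) b (Some t).
    case: (boolP (adm (s, b, t))) => [/okE[u]|_]; first by exists u.
    by exists w.
  exists (u ++ w) => [|e]; last first.
    rewrite inE => /predU1P[->|el] e_adm; apply/reach_cat.
      by exists (Some t), b, false; rewrite orbF; split=> //; apply: u_st.
    by exists (Some e.1.1), false, e.1.2; split=> //; apply: w_l.
  split=> [|s']; first exact: descends_cat u_le w_le.
  by apply/reach_cat; exists (Some s'), false, false.
exists w => //; split=> // s t.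
  by move=> ts; apply: (w_all (s, true, t)); rewrite ?mem_enum.
by move=> st s_odd; apply: (w_all (s, false, t));
  rewrite ?mem_enum //= st eqxx -st.
Qed.

(** Between a word for [f] and one for [g], the state [x] is killed. Every path then crosses at some
    [y] other than [x], where the two rankings agree. *)
Lemma change_word f g x : rank_cover f -> rank_cover g ->
  (forall y, y != x -> f y = g y) -> f x <> g x -> exists w, realizes f g w.
Proof.
move=> [f_lt f_odd] [g_lt g_odd] fg fgx.
have [u [u_le u_lt u_eq] u_id] := self_word f.
have [v [v_le v_lt v_eq] v_id] := self_word g.
have [w [wE Ew]] := kill_word x.
have via s b1 y b2 t : y != x -> reach u (Some s) b1 (Some y) ->
    reach v (Some y) b2 (Some t) ->
    reach (u ++ w ++ v) (Some s) (b1 || b2) (Some t).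
  move=> yx sy yt; apply/reach_cat; exists (Some y), b1, b2; split=> //.
  apply/reach_cat; exists (Some y), false, b2; split=> //.
  by have [|b yy] := Ew (Some y) (Some y); rewrite ?eqxx //;
    have [_ <-] := wE _ _ _ yy.
exists (u ++ w ++ v); split=> [s b q|s t gf|s t fg_st f_st].
- move=> /reach_cat[r [b1 [b' [/u_le[y [-> le1 lt1]] + ->]]]].
  move=> /reach_cat[r' [b2 [b3 [+ + ->]]]] => yr' r'q.
  have [/= /andP[/eqP r'E yx] b2F] := wE _ _ _ yr'; subst r'.
  rewrite {}b2F //=; rewrite (inj_eq Some_inj) in yx.
  have [t [-> le2 lt2]] := v_le _ _ _ r'q; rewrite -(fg y) // in le2 lt2.
  exists t; split=> //; first exact: leq_trans le2 le1.
  by case/orP => [/lt1|/lt2] lt;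
    [exact: leq_ltn_trans le2 lt|exact: leq_trans lt le1].
- have [tx|tx] := eqVneq t x; last first.
    by apply: (@via s true t false t) => //; apply: u_lt; rewrite (fg _ tx).
  subst t; have [sx|sx] := eqVneq s x; last first.
    by apply: (@via s false s true x) => //; apply: v_lt; rewrite -(fg _ sx).
  (* A path from [x] to [x] must cross elsewhere: at a [y] with [g y = f x] if that is odd, which
     differs from [x] since [f x <> g x], and otherwise at a [y] of rank [f x - 1]. *)
  subst s; case: (boolP (odd (f x))) => [fx_odd|fx_even].
    have [y gy] := g_odd _ fx_odd (f_lt x).
    have yx : y != x by apply/eqP => yx; case: fgx; rewrite -gy yx.
    apply: (@via x false y true x) => //.
      by apply: u_eq; rewrite // (fg _ yx).
    by apply: v_lt; rewrite gy.
  have [||y fy] := f_odd (f x).-1; [lia|have := f_lt x; lia|].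
  have yx : y != x by apply/eqP => yx; rewrite yx in fy; lia.
  have xy : reach u (Some x) true (Some y) by apply: u_lt; lia.
  have : g x <= g y by rewrite -(fg _ yx) fy; lia.
  rewrite leq_eqVlt => /predU1P[gxy|gxy];
    last exact: (@via x true y true x _ xy (v_lt _ _ _)).
  apply: (@via x true y false x _ xy) => //.
  by apply: v_eq => //; rewrite -(fg _ yx) fy; lia.
- have [tx|tx] := eqVneq t x; last first.
    by apply: (@via s false t false t) => //; apply: u_eq;
      rewrite // fg_st (fg _ tx).
  subst t; have [sx|sx] := eqVneq s x; first by rewrite sx in fg_st.
  by apply: (@via s false s false x) => //; apply: v_eq; rewrite -(fg _ sx).
Qed.

Lemma relabel_word f g (pi : {perm X}) : (forall s, g (pi s) = f s) ->
  exists w, realizes f g w.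
Proof.
move=> gf; have [u [u_le u_lt u_eq] _] := self_word f.
have [w [wE Ew]] := perm_word pi.
have w_pi s : reach w (Some s) false (Some (pi s)).
  by have [|b ss] := Ew (Some s) (Some (pi s)) => //;
    have [_ <-] := wE _ _ _ ss.
have via s b t : reach u (Some s) b (Some (pi^-1%g t)) ->
    reach (u ++ w) (Some s) b (Some t).
  move=> st; apply/reach_cat; exists (Some (pi^-1%g t)), b, false.
  by rewrite orbF; split=> //; have := w_pi (pi^-1%g t); rewrite permKV.
have gE t : g t = f (pi^-1%g t) by rewrite -gf permKV.
exists (u ++ w); split=> [s b q|s t ts|s t st s_odd].
- move=> /reach_cat[r [b1 [b2 [/u_le[t [-> le1 lt1]] tq ->]]]].
  have [/eqP qE b2F] := wE _ _ _ tq; subst q; exists (pi t).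
  by rewrite gf b2F ?orbF.
- by apply/via/u_lt; rewrite -gE.
- by apply/via/u_eq; rewrite -?gE.
Qed.

(* Transpositions move a system of representatives of the odd values of f onto
   one for g; the other values can then be changed one at a time. *)
Lemma ranking_word f g :
  rank_cover f -> rank_cover g -> exists w, realizes f g w.
Proof.
move=> f_rank [g_lt g_odd].
have /choice[y yP] : forall i, exists x, i < m -> g x = i.*2.+1.
  move=> i; have [im|] := boolP (i < m); last by exists x0.
  have [||x gx] := g_odd i.*2.+1; [by rewrite /= odd_double|lia|by exists x].
have cover h : (forall x, h x < 2 * m) ->
    (forall i, i < m -> h (y i) = i.*2.+1) -> rank_cover h.
  move=> h_lt hy; split=> // k k_odd km; exists (y k./2); rewrite hy; lia.
have [h [h_rank hy [u u_fh]]] : exists h, [/\ rank_cover h,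
    forall i, i < m -> h (y i) = i.*2.+1 & exists w, realizes f h w].
  suff /(_ m (leqnn m)) : forall k, k <= m -> exists h, [/\ rank_cover h,
    forall i, i < k -> h (y i) = i.*2.+1 & exists w, realizes f h w] by [].
  elim=> [|k IH] km.
    by exists f; split=> //; have [w] := self_word f; exists w.
  have [h [h_rank hy [w w_fh]]] := IH (ltnW km).
  have [||x hx] := h_rank.2 k.*2.+1; [by rewrite /= odd_double|lia|].
  (* The swap puts the value [k.*2.+1] at [y k]. The representatives already placed carry other odd
     values and stay fixed. *)
  pose h' := h \o tperm x (y k).
  have h'_rank : rank_cover h'.
    split=> [z|j j_odd jm]; first exact: h_rank.1.
    have [z hz] := h_rank.2 j j_odd jm; exists (tperm x (y k) z).
    by rewrite /h' /= tpermK.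
  exists h'; split=> // [i|].
    rewrite ltnS leq_eqVlt => /predU1P[->|ik]; first by rewrite /h' /= tpermR.
    rewrite /h' /= tpermD ?hy //; apply/eqP => E.
      by have := hy i ik; rewrite -E hx; lia.
    by have := yP i; rewrite -E yP //; lia.
  have [|w' w'_h] := @relabel_word h h' (tperm x (y k)).
    by move=> s; rewrite /h' /= tpermK.
  by exists (w ++ w'); apply: realizes_cat w_fh w'_h.
(* [h] and [g] agree on the representatives [y i], so every mixture of them still takes all odd
   values. *)
pose patch (l : seq X) z := if z \in l then g z else h z.
suff [w w_hg] : exists w, realizes h (patch (enum X)) w.
  have -> : g = patch (enum X) by apply/funext => z; rewrite /patch mem_enum.
  by exists (u ++ w); apply: realizes_cat u_fh w_hg.
have patch_rank l : rank_cover (patch l).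
  apply: cover => [x|i im]; rewrite /patch; case: ifP => // _.
  - exact: h_rank.1.
  - exact: yP.
  - exact: hy.
elim: (enum X) => [|x l [w w_hl]].
  by have [w w_h _] := self_word h; exists w.
have [/funext<-|] := pselect (patch l =1 patch (x :: l)); first by exists w.
move=> ne; have [||z zx|eq_x|v v_l] :=
  @change_word (patch l) (patch (x :: l)) x => //.
- by rewrite /patch inE (negbTE zx).
- apply: ne => z; have [->//|zx] := eqVneq z x.
  by rewrite /patch inE (negbTE zx).
- by exists (w ++ v); apply: realizes_cat w_hl v_l.
Qed.

End Rankings.

(** * The lower bound for a fixed m *)

Lemma num_Q_rankings_le (m : nat) : 0 < m ->
  #|[set h : {ffun X -> 'I_(2 * m)} | Q_ranking h]| <= C_NBW seven_nbw.
Proof.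
move=> m_gt0; rewrite cardsE -card_sig.
pose I : finType := {h : {ffun X -> 'I_(2 * m)} | Q_ranking h}.
rewrite -[leqLHS]/#|I|.
pose rk (i : I) (x : X) : nat := val i x.
have rk_cover i : rank_cover m (rk i).
  split=> [x|k k_odd km]; first exact: ltn_ord.
  have /forallP/(_ (Ordinal km))/implyP/(_ k_odd)/existsP[x /eqP hx] := valP i.
  by exists x; rewrite /rk hx.
have [->//|I_gt0] := posnP #|I|.
have [i0 _] : exists i0 : I, true by case/card_gt0P: I_gt0 => i; exists i.
have /choice[W WP] : forall ij : I * I, exists w,
  realizes (rk ij.1) (rk ij.2) w.
  by move=> ij; apply: ranking_word.
(* Cycling through the enumeration makes every ranking recur infinitely often. *)
pose R k := nth i0 (enum I) (k %% #|I|).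
(* The leading letter 4 fixes every nonfinal state; it makes the blocks nonempty, since a realizing
   word may be empty. *)
have [//|alpha [P [P0 P_lt PE]]] :=
  concat_blocks (w := fun k => (inord 4 : 'I_7) :: W (R k, R k.+1)).
have real1 k : realizes (rk (R k)) (rk (R k.+1)) (factor alpha (P k) (P k.+1)).
  rewrite PE; have /= := WP (R k, R k.+1); move: (W _) => w [w_le w_lt w_eq].
  have consE s b q : reach (inord 4 :: w) (Some s) b q <-> reach w (Some s) b q.
    rewrite reach_cons; split=> [[r [b' [+ + ->]]]|sq].
      by rewrite !inE /= inordK //= => /andP[/eqP->].
    by exists (Some s), b; rewrite !inE /= inordK //= eqxx.
  split=> [s b q /consE/w_le//|s t /w_lt ?|s t /w_eq E /E ?]; exact/consE.
have real k l : k < l ->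
    realizes (rk (R k)) (rk (R l)) (factor alpha (P k) (P l)).
  move=> /subnKC <-; elim: (l - k.+1) => [|d IH]; first by rewrite addn0.
  rewrite addnS (@factor_cat _ alpha _ (P (k.+1 + d))) ?(bounds_homo P_lt) //.
  - by apply: realizes_cat IH (real1 _).
  - by lia.
apply: (@fooling_bound _ seven_nbw I alpha P R) => //.
- move=> i N; exists (N * #|I| + index i (enum I)).
    by apply: leq_trans (leq_addr _ _); rewrite leq_pmulr.
  rewrite /R modnMDl modn_small ?nth_index ?mem_enum //.
  by rewrite cardE index_mem mem_enum.
- move/(accepts_blocks _ _ P0 P_lt) => [q [b [q0 qP inf]]].
  have /choice[z zP] : forall k, exists z, q k = Some z.
    elim=> [|k [z qk]].
      by move: q0; rewrite inE; case: (q 0) => // z; exists z.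
    have := qP k; rewrite qk; have [sound _ _] := real1 k.
    by move=> /sound[t [-> _ _]]; exists t.
  apply: (@decreasing_absurd (fun k => rk (R k) (z k)) b) inf => k.
    have := qP k; rewrite !zP; have [sound _ _] := real1 k.
    by move=> /sound[t [[->]]].
  move=> bk; have := qP k; rewrite !zP; have [sound _ _] := real1 k.
  by move=> /sound[t [[->] _ ->]].
- suff pump f g x : rk f x < rk g x -> pumpable seven_nbw alpha P R f g.
    move=> f g fg; have [x] : exists x, rk f x <> rk g x.
      apply: contrapT => /forallNP eq_fg; move/eqP: fg; apply.
      by apply/val_inj/ffunP => x; apply/val_inj; apply: contrapT (eq_fg x).
    by move/eqP; rewrite neq_ltn => /orP[/pump|/pump]; [left|right].
  move=> fg k l beta Q /andP[k_gt0 kl] Rk Rl Q0 Q_lt QE0 QE.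
  (* A state of the top rank [2m - 1], which is odd, reaches every state at any later boundary: by a
     drop, or by equality at that odd value. *)
  have [s s_max] : exists s, rk (R 0) s = (2 * m).-1.
    by apply: (rk_cover _).2; lia.
  have [b0 sx] : exists b0, reach (factor alpha 0 (P k)) (Some s) b0 (Some x).
    have := real _ _ k_gt0; rewrite P0 Rk => -[_ r_lt r_eq].
    have := (rk_cover g).1 x; rewrite -(ltn_predK (m := 0) (n := 2 * m)) ?ltnS;
      last by lia.
    rewrite -s_max leq_eqVlt => /predU1P[gx|/r_lt]; last by exists true.
    by exists false; apply: r_eq; rewrite // s_max; lia.
  have xx : reach (factor alpha (P k) (P l)) (Some x) true (Some x).
    by have := real _ _ kl; rewrite Rk Rl => -[_ r_lt _]; apply: r_lt.
  apply/(accepts_blocks _ _ Q0 Q_lt).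
  exists (fun j => if j is 0 then Some s else Some x).
  exists (fun j => if j is 0 then b0 else true); split=> [|[|j]|N].
  - by rewrite inE.
  - by rewrite QE0.
  - by rewrite QE.
  - by exists N.+1.
Qed.

End SevenLetters.

(** A transposition of neighbours and the cyclic shift generate the symmetric group. On a single
    point (n = 2) the two points coincide, whence the conditional second clause. *)
Lemma perm_generators k : exists (x0 x1 : 'I_k.+1) (c : 'S_k.+1),
  <<[set tperm x0 x1; c]>>%g = [set: 'S_k.+1] /\
  (x0 = x1 -> forall x y : 'I_k.+1, x = y).
Proof.
case: k => [|k].
  exists ord0, ord0, 1%g; split=> [|_ x y]; last by rewrite !ord1.
  apply/setP => s; rewrite inE; suff -> : s = 1%g by rewrite group1.
  by apply/permP => x; rewrite !ord1.
exists 0%R, 1%R, (perm (GRing.addrI 1%R)); split=> //.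
by apply: gen_tpermn_circular_shift; rewrite GRing.subr0 coprimen1.
Qed.

Theorem theorem4p9 (n : nat) (hn : 1 < n) :
  exists (Sigma : finType) (B : nbw Sigma),
    [/\ #|Sigma| = 7, #|state B| = n & L n <= C_NBW B].
Proof.
case: n hn => [|[|k]] // _.
have [x0 [x1 [c [gen x01]]]] := perm_generators k.
exists 'I_7, (seven_nbw x0 x1 c); split.
- by rewrite card_ord.
- by rewrite card_option card_ord.
apply/bigmax_leqP_seq => m; rewrite mem_index_iota => /andP[m_gt0 _] _.
exact: num_Q_rankings_le.
Qed.
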